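(* Let $b\geq 3$ be an integer and $W\subsetneq\{0,1,\ldots,b-1\}$ with $|W|\geq 2$. If $\mathcal{S}=\{q_1,\ldots,q_v\}$ is any finite set of prime numbers not dividing $b$, then there are only finitely many rational numbers $r/s$ in $C_{b,W}$ with $s$ consisting only of prime factors in $\mathcal{S}$. In particular, for a rational number $p/q$ with $(b,q)=1$, only finitely many of its positive integer powers $(p/q)^n$ (counted as distinct real numbers) lie in $C_{b,W}$. Moreover, $C_{b,W}$ contains at most finitely many rational numbers $p/q$ where $q$ is a safe prime, i.e. $q$ and $(q-1)/2$ are both prime numbers.
   Context: For an integer $b\geq 3$ and a digit set $W\subseteq\{0,1,\ldots,b-1\}$ with $2\leq|W|\leq b-1$, the missing digit Cantor set $C_{b,W}$ is the set of real numbers in $[0,1]$ having a base $b$ expansion $\sum_{j\geq1}w_jb^{-j}$ with all digits $w_j\in W$. Finiteness refers to finiteness of a set of real numbers. *)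

(* Defs.v *)
From HB Require Import structures.
From mathcomp Require Import all_boot all_order all_algebra.
From mathcomp Require Import boolp classical_sets functions cardinality.
From mathcomp Require Import reals topology normedtype sequences.
Set Implicit Arguments.
Unset Strict Implicit.
Unset Printing Implicit Defensive.
Import Order.TTheory GRing.Theory Num.Theory.
Import numFieldNormedType.Exports.
Local Open Scope classical_set_scope.
Local Open Scope ring_scope.

(* The digit sequence is indexed from 0, so [w j] is the coefficient of
   b^-(j+1). *)
Definition missing_digit_cantor (R : realType) (b : nat) (W : {set 'I_b}) :
    set R :=
  [set x : R | 0 <= x <= 1 /\
     exists w : nat -> 'I_b, (forall j, w j \in W) /\
       (series (fun j => (w j)%:R / b%:R ^+ j.+1) : nat -> R) @ \oo --> x].

(* On nat, [q.-1./2] rounds down; this is harmless, since the only even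
   prime is 2, for which [q.-1./2 = 0] is not prime. *)
Definition safe_prime (q : nat) : bool := prime q && prime q.-1./2.

(* Main.v *)
(* If a is a missing digit, C misses the open interval (a/b, (a+1)/b), and C is
   stable under x |-> bx - w with w the first digit of x.  Hence if r/s is in C,
   no residue r b^k mod s lies in the gap (as/b, (a+1)s/b).

   Smooth denominators: choose a power B of b with B = 1 mod q^2 for every q in
   S and take r/s in lowest terms.  The sums 1 + B + ... + B^(n-1) then run
   through all residues mod s, so the r B^n run through the progression
   r + (B-1)t mod s, which meets the gap as soon as s > b(B-1).

   Safe primes: for q > b^4 the powers of b form a subgroup H of index at most 2
   in the units mod q.  If r H misses the gap, all residues in the gap lie in one
   coset of H.  For b < n < q/b some y and ny mod q both lie in the gap, so n
   is in H; multiplying by b^2 covers all n < q/b, and n reduces to smaller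
   residues through ceil(q/n) n - q < n, so H is everything, a contradiction. *)

Require Import Defs.
From HB Require Import structures.
From mathcomp Require Import all_boot all_order all_algebra cyclic finfield.
From mathcomp Require Import zify lra.
From mathcomp Require Import boolp classical_sets functions cardinality.
From mathcomp Require Import reals topology normedtype sequences.
Set Implicit Arguments.
Unset Strict Implicit.
Unset Printing Implicit Defensive.
Import Order.TTheory GRing.Theory Num.Theory.
Import numFieldNormedType.Exports.
Local Open Scope classical_set_scope.
Local Open Scope ring_scope.

(** * Digit expansions, the shift map and the gap of a missing digit *)

Lemma digit_series_bounds (R : realType) (b : nat) (w : nat -> 'I_b) (n : nat) :
  0 <= series (fun j => (w j)%:R / b%:R ^+ j.+1 : R) n <= 1 - (b%:R ^+ n)^-1.
Proof.
have b0 : (0 < b)%N by exact: leq_ltn_trans (ltn_ord (w 0)).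
have bR : 0 < b%:R :> R by rewrite ltr0n.
elim: n => [|n /andP[IH0 IH1]].
  by rewrite /series /= big_geq // expr0 invr1 subrr lexx.
rewrite seriesSr; apply/andP; split.
  by apply: addr_ge0 => //; rewrite divr_ge0 ?ler0n ?exprn_ge0 // ltW.
have wb : (w n)%:R <= b%:R - 1 :> R.
  by rewrite lerBrDr natr1 ler_nat ltn_ord.
have e : (b%:R ^+ n)^-1 = b%:R / b%:R ^+ n.+1 :> R.
  by rewrite exprS invfM mulrA divff ?mul1r // gt_eqF.
have : (w n)%:R / b%:R ^+ n.+1 <= (b%:R - 1) / b%:R ^+ n.+1 :> R.
  by apply: ler_wpM2r => //; rewrite invr_ge0 exprn_ge0 // ltW.
move: IH1; rewrite e mulrBl mul1r; lra.
Qed.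

Lemma digit_series_cons (R : realType) (b : nat) (w : nat -> 'I_b) (n : nat) :
  series (fun j => (w j.+1)%:R / b%:R ^+ j.+1 : R) n =
  b%:R * series (fun j => (w j)%:R / b%:R ^+ j.+1) n.+1 - (w 0%N)%:R.
Proof.
have b0 : (0 < b)%N by exact: leq_ltn_trans (ltn_ord (w 0)).
have bR : b%:R != 0 :> R by rewrite pnatr_eq0 -lt0n.
rewrite /series /= big_nat_recl // expr1 mulrDr mulrCA divff // mulr1.
rewrite addrC addKr.
rewrite mulr_sumr; apply: eq_bigr => i _.
by rewrite [b%:R ^+ i.+2]exprS invfM mulrCA [b%:R * _]mulrA divff // mul1r.
Qed.

(** Dropping the first digit turns the expansion of [x] into one of [b * x - w]. The limit stays in
    [0, 1] because every partial sum does and the two half-lines are closed. *)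
Lemma cantor_shift (R : realType) (b : nat) (W : {set 'I_b}) (x : R) :
  missing_digit_cantor W x ->
  exists2 w, w \in W & missing_digit_cantor W (b%:R * x - w%:R).
Proof.
move=> [_ [w [wW wx]]]; exists (w 0%N) => //.
have cv : (series (fun j => (w j.+1)%:R / b%:R ^+ j.+1) : nat -> R) @ \oo -->
    b%:R * x - (w 0%N)%:R.
  rewrite (_ : series _ = fun n =>
      b%:R * series (fun j => (w j)%:R / b%:R ^+ j.+1) n.+1 - (w 0%N)%:R :> R).
    apply: cvgB; last exact: cvg_cst.
    apply: cvgMr.
    by rewrite (cvg_shiftS (series (fun j => (w j)%:R / b%:R ^+ j.+1 : R))).
  by apply/funext => n; exact: digit_series_cons.
split; last by exists (fun j => w j.+1); split.
have bnd n := digit_series_bounds R (fun j => w j.+1) n.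
apply/andP; split.
  apply: (closed_cvg (fun y : R => 0 <= y) _ _ _ cv); first exact: closed_ge.
  by near=> n; case/andP: (bnd n).
apply: (closed_cvg (fun y : R => y <= 1) _ _ _ cv); first exact: closed_le.
near=> n; case/andP: (bnd n) => _ /le_trans; apply.
by rewrite gerBl invr_ge0 exprn_ge0.
Unshelve. all: by end_near. Qed.

(** Induction on [k]: a shift replaces [r] by [b * r - w * s], which is [b * r] modulo [s]. For
    [k = 0] the upper bound forces [z < s], so [z = r] unless [r = s], and the strict bounds leave
    only [a] as first digit. Strictness is essential, as endpoints of the gap may have a second
    expansion. *)
Lemma cantor_orbit_avoids_gap (R : realType) (b : nat) (W : {set 'I_b})
    (a : 'I_b) (s r k z : nat) :
  a \notin W -> (0 < s)%N -> missing_digit_cantor W (r%:R / s%:R : R) ->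
  z = (r * b ^ k)%N %[mod s] -> ~ (a * s < b * z < a.+1 * s)%N.
Proof.
move=> aW s0; have sR : 0 < s%:R :> R by rewrite ltr0n.
elim: k r => [|k IHk] r Cr zr /andP[az za].
  have b0 : (0 < b)%N by exact: leq_ltn_trans (ltn_ord a).
  have zs : (z < s)%N.
    rewrite -(ltn_pmul2l b0); apply: leq_trans za _.
    by rewrite leq_mul2r ltn_ord orbT.
  have rs : (r <= s)%N.
    by have [/andP[_]] := Cr; rewrite ler_pdivrMr // mul1r ler_nat.
  move: zr; rewrite expn0 muln1 (modn_small zs) => zr.
  have [rltz|sr] := ltnP r s; last first.
    have {sr rs} rE : r = s by apply/eqP; rewrite eqn_leq rs.
    by move: az; rewrite zr rE modnn muln0 ltn0.
  rewrite (modn_small rltz) in zr; subst z.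
  have [w wW [/andP[]]] := cantor_shift Cr.
  rewrite subr_ge0 lerBlDr mulrA ler_pdivlMr // ler_pdivrMr // => w1 w2 _.
  have {}w1 : (w * s <= b * r)%N by rewrite -(ler_nat R) !natrM.
  have {}w2 : (b * r <= w.+1 * s)%N.
    by rewrite -(ler_nat R) !natrM -natr1 [(w%:R + 1)]addrC.
  have wa : (w < a.+1)%N.
    by rewrite -(ltn_pmul2r s0); exact: leq_ltn_trans za.
  have aw : (a < w.+1)%N.
    by rewrite -(ltn_pmul2r s0); exact: leq_trans az _.
  have aE : a = w by apply/val_inj => /=; lia.
  by rewrite aE wW in aW.
have [w wW Cw] := cantor_shift Cr.
have wr : (w * s <= b * r)%N.
  have [/andP[]] := Cw.
  by rewrite subr_ge0 mulrA ler_pdivlMr // -!natrM ler_nat.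
apply: (IHk (b * r - w * s)%N); last by rewrite az za.
  rewrite (_ : _ / _ = b%:R * (r%:R / s%:R) - w%:R) //.
  by rewrite natrB // mulrBl !natrM mulfK ?gt_eqF // mulrA.
rewrite zr expnS mulnA [(r * b)%N]mulnC -[in LHS](subnK wr).
by rewrite mulnDl mulnAC addnC modnMDl.
Qed.

(** * A finiteness criterion, and progressions crossing an interval *)

Lemma finite_bounded_denominator (R : realType) (A : set R) (N : nat) :
  (forall x, A x -> exists r s : nat, [/\ (r <= s)%N, (s <= N)%N
     & x = r%:R / s%:R]) -> finite_set A.
Proof.
move=> AN.
apply: (@sub_finite_set _ _
  [set (rs.1%:R / rs.2%:R : R) | rs in (`I_N.+1 `*` `I_N.+1)%classic]).
  move=> x /AN[r [s [rs sN ->]]]; exists (r, s) => //=.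
  by split=> /=; rewrite ltnS // (leq_trans rs).
by apply: finite_image; apply: finite_setX; exact: finite_II.
Qed.

(** A step shorter than the interval cannot jump over it: the first term beyond [lo] is at most
    [lo + d]. *)
Lemma progression_meets_interval (x d lo len : nat) :
  (x <= lo)%N -> (0 < d < len)%N ->
  exists t, (lo < x + d * t < lo + len)%N.
Proof.
move=> xlo /andP[d0 dlen]; exists ((lo - x) %/ d).+1.
have := divn_eq (lo - x) d; have := ltn_pmod (lo - x) d0.
set u := (_ %/ _)%N; set v := (_ %% _)%N; move=> vd e.
rewrite mulnS [(d * u)%N]mulnC; apply/andP; split; lia.
Qed.

(** * Geometric sums modulo [s] *)

Lemma expn_geom (B n : nat) : (0 < B)%N ->
  (B ^ n = 1 + B.-1 * \sum_(i < n) B ^ i)%N.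
Proof. by move=> B0; rewrite -predn_exp add1n prednK // expn_gt0 B0. Qed.

Lemma geom_sumM (B m n : nat) : (1 < B)%N ->
  (\sum_(i < m * n) B ^ i = (\sum_(i < m) B ^ i) * \sum_(j < n) (B ^ m) ^ j)%N.
Proof.
move=> B1; have B0 : (0 < B.-1)%N by case: B B1 => [|[]].
by apply/eqP; rewrite -(eqn_pmul2l B0) mulnA -!predn_exp expnM.
Qed.

Lemma geom_sumB (B i j : nat) : (i <= j)%N ->
  (\sum_(k < j) B ^ k = \sum_(k < i) B ^ k + B ^ i * \sum_(k < j - i) B ^ k)%N.
Proof.
move=> ij; rewrite -[in LHS](subnKC ij) big_split_ord /= big_distrr /=.
by congr addn; apply: eq_bigr => k _; rewrite expnD.
Qed.

Lemma geom_sum_mod (B q n : nat) : B = 1 %[mod q] ->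
  (\sum_(i < n) B ^ i)%N = n %[mod q].
Proof.
move=> B1; rewrite -modn_summ (eq_bigr (fun=> 1 %% q)%N).
  by rewrite modn_summ sum1_card card_ord.
by move=> i _; rewrite -modnXm B1 modnXm exp1n.
Qed.

(* Modulo q^2 the sum of the B^i over i < q is q, so it contains exactly one
   factor q; factoring it out replaces B by B^q and n by n/q. *)
Lemma pfactor_dvdn_geom_sum (q k B n : nat) :
  prime q -> (1 < B)%N -> B = 1 %[mod q ^ 2] ->
  (q ^ k %| \sum_(i < n) B ^ i)%N -> (q ^ k %| n)%N.
Proof.
move=> qp; have q0 := prime_gt0 qp.
elim: k B n => [|k IHk] B n B1 Bq; first by rewrite expn0 !dvd1n.
have Bq1 : B = 1 %[mod q].
  have /eqP : B == 1 %[mod q * q] by rewrite mulnn Bq.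
  by move=> /(congr1 (modn^~ q)); rewrite !modn_dvdm ?dvdn_mulr.
move=> dv; have : (q %| n)%N.
  rewrite /dvdn -(geom_sum_mod n Bq1) -/(dvdn _ _).
  by apply: dvdn_trans dv; rewrite expnS dvdn_mulr.
case/dvdnP => m nE; rewrite nE mulnC in dv *.
move: dv; rewrite geom_sumM //.
have qsum := geom_sum_mod q Bq.
have : (q %| \sum_(i < q) B ^ i)%N.
  by rewrite /dvdn (geom_sum_mod q Bq1) modnn.
case/dvdnP => u uE; rewrite uE in qsum *.
have cqu : coprime (q ^ k) u.
  apply: coprimeXl; rewrite prime_coprime //; apply/negP => qu.
  have : (q ^ 2 %| u * q)%N by rewrite -mulnn dvdn_pmul2r.
  rewrite /dvdn qsum -/(dvdn _ _) -mulnn -{3}[q]muln1 dvdn_pmul2l // dvdn1.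
  by move=> /eqP q1; rewrite q1 in qp.
rewrite expnS [(u * q)%N]mulnC -mulnA !dvdn_pmul2l // Gauss_dvdr //.
apply: IHk; first by rewrite -(exp1n q) ltn_exp2r.
by rewrite -modnXm Bq modnXm exp1n.
Qed.

Lemma dvdn_geom_sum (s B n : nat) : (0 < s)%N -> (1 < B)%N ->
  (forall q, prime q -> (q %| s)%N -> B = 1 %[mod q ^ 2]) ->
  (s %| \sum_(i < n) B ^ i)%N -> (s %| n)%N.
Proof.
move=> s0 B1 Bq dv; apply/dvdn_partP => // q.
rewrite mem_primes => /and3P[qp _ qs]; rewrite p_part.
apply: pfactor_dvdn_geom_sum (Bq q qp qs) _ => //.
by apply: dvdn_trans dv; exact: pfactor_dvdnn.
Qed.

(** Two sums of lengths [i <= j] differ by [B ^ i] times the sum of length [j - i]. If they agree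
    modulo [s], then [s] divides [j - i], so lengths below [s] give distinct residues; an injection
    of a finite set into itself is onto. *)
Lemma geom_sum_full_period (s B r t : nat) : (0 < s)%N -> (1 < B)%N ->
  (forall q, prime q -> (q %| s)%N -> B = 1 %[mod q ^ 2]) -> coprime s r ->
  exists n, (r * \sum_(i < n) B ^ i)%N = t %[mod s].
Proof.
move=> s0 B1 Bq sr.
(* A common prime factor of [s] and [B] would divide both [B] and [B - 1]. *)
have sB : coprime s B.
  have g0 : (0 < gcdn s B)%N by rewrite gcdn_gt0 s0.
  rewrite /coprime eqn_leq g0 andbT leqNgt; apply/negP => /pdiv_prime.
  set q := pdiv _ => qp.
  have /andP[qs qB] : (q %| s)%N && (q %| B)%N.
    by rewrite -dvdn_gcd; exact: pdiv_dvd.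
  have /eqP := Bq q qp qs; rewrite eqn_mod_dvd ?(ltnW B1) // => q2.
  have : (q %| B - 1)%N by apply: dvdn_trans q2; rewrite -mulnn dvdn_mulr.
  by rewrite (dvdn_subr (ltnW B1) qB) dvdn1 => /eqP q1; rewrite q1 in qp.
pose f (i : 'I_s) : 'I_s := Ordinal (ltn_pmod (r * \sum_(k < i) B ^ k) s0).
have inj_lt (i j : 'I_s) : f i = f j -> (i <= j)%N -> i = j.
  move=> /(congr1 val) /= /eqP fij ij; apply/val_inj/eqP.
  rewrite eqn_leq ij -subn_eq0 /=.
  have : (s %| j - i)%N.
    apply: (dvdn_geom_sum s0 B1 Bq).
    move: fij; rewrite eq_sym (geom_sumB _ ij) eqn_mod_dvd ?leq_mul ?leq_addr //.
    by rewrite -mulnBr addKn !Gauss_dvdr // coprimeXr.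
  by rewrite /dvdn modn_small // (leq_ltn_trans (leq_subr _ _)).
have inj_f : injective f.
  move=> i j fij; case: (leqP i j) => [|/ltnW] ij; first exact: inj_lt.
  by apply/esym/inj_lt.
exists (invF inj_f (Ordinal (ltn_pmod t s0))).
have /(congr1 val) /= -> := f_invF inj_f (Ordinal (ltn_pmod t s0)).
by [].
Qed.

(** * Cosets of the powers of [b] modulo a safe prime *)

Lemma same_coset_sym (F : fieldType) (g : F) (m : nat) (x y : F) :
  m.-primitive_root g -> (exists k, y = x * g ^+ k) ->
  exists k, x = y * g ^+ k.
Proof.
(* Since [g ^+ m = 1], the power [g ^+ (k * m.-1)] is the inverse of [g ^+ k]. *)
move=> gm [k ->]; exists (k * m.-1)%N; rewrite -mulrA -exprD -mulnS.
rewrite (prednK (prim_order_gt0 gm)) mulnC exprM (prim_expr_order gm).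
by rewrite expr1n mulr1.
Qed.

Lemma same_coset_trans (F : fieldType) (g x y z : F) :
  (exists k, y = x * g ^+ k) -> (exists k, z = y * g ^+ k) ->
  exists k, z = x * g ^+ k.
Proof. by move=> [k ->] [l ->]; exists (k + l)%N; rewrite exprD mulrA. Qed.

(** Otherwise [r], [x], [y] lie in three distinct cosets, which together with 0 (the value of [f] at
    [None]) give [3 * m + 1] elements, more than the field has. *)
Lemma same_coset_of_index_lt3 (F : finFieldType) (g : F) (m : nat) (r x y : F) :
  m.-primitive_root g -> (#|F|.-1 < 3 * m)%N ->
  r != 0 -> x != 0 -> y != 0 ->
  ~ (exists k, x = r * g ^+ k) -> ~ (exists k, y = r * g ^+ k) ->
  exists k, y = x * g ^+ k.
Proof.
move=> gm cF r0 x0 y0 nx ny; apply: contrapT => nxy.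
have m0 := prim_order_gt0 gm.
have g0 : g != 0.
  apply/negP => /eqP g0; have := prim_expr_order gm; rewrite g0 expr0n.
  by rewrite eqn0Ngt m0 => /eqP; rewrite eq_sym oner_eq0.
pose c (i : 'I_3) := nth 0 [:: r; x; y] i.
pose f (u : option ('I_3 * 'I_m)) : F :=
  if u is Some ik then c ik.1 * g ^+ ik.2 else 0.
have c0 i : c i != 0 by case: i => [[|[|[|]]]].
have cc i j : (exists k, c j = c i * g ^+ k) -> i = j.
  move=> e; have e' := same_coset_sym gm e; apply/val_inj.
  by case: i j e e' => [[|[|[|//]]] ?] [[|[|[|//]]] ?].
have inj_f : injective f.
  move=> [[i k]|] [[j l]|] //=.
  - move=> e; have ij : i = j.
      apply: cc; apply: (@same_coset_trans _ _ _ (c i * g ^+ k)).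
        by exists k.
      by rewrite e; apply: (same_coset_sym gm); exists l.
    move: e; rewrite -ij => /(mulfI (c0 i)) /eqP.
    rewrite (eq_prim_root_expr gm) !modn_small // => /eqP kl.
    by congr (Some (_, _)); apply: val_inj.
  - by move/eqP; rewrite mulf_eq0 (negbTE (c0 i)) expf_eq0 (negbTE g0) andbF.
  - by move/esym/eqP; rewrite mulf_eq0 (negbTE (c0 j)) expf_eq0 (negbTE g0) andbF.
have := leq_card f inj_f; rewrite card_option card_prod !card_ord.
move=> h; move: cF; rewrite ltnNge -ltnS => /negP; apply.
exact: leq_trans h (leqSpred _).
Qed.

Lemma coset_meets_gap (b q m a r : nat) :
  prime q -> (1 < b)%N -> (b ^ 4 < q)%N -> (a < b)%N ->
  m.-primitive_root (b%:R : 'F_q) -> (q.-1 < 3 * m)%N -> ~~ (q %| r)%N ->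
  exists k z, z = (r * b ^ k)%N %[mod q] /\ (a * q < b * z < a.+1 * q)%N.
Proof.
move=> qp b1 bq ab gm qm qr; apply: contrapT => nkz.
have q0 := prime_gt0 qp.
have b4 : (b ^ 4 = b * (b * (b * b)))%N by rewrite !expnS expn0 muln1.
have bq1 : (b * (b * (b * b)) < q)%N by rewrite -b4.
have b2q : (b * b.+1 < q)%N by nia.
have bltq : (b < q)%N by nia.
pose v (n : nat) : 'F_q := n%:R.
have v0 n : (v n == 0) = (q %| n)%N by rewrite (dvdn_pcharf (pchar_Fp qp)).
have vlt n : (0 < n < q)%N -> v n != 0.
  by move=> /andP[n0 nq]; rewrite v0 gtnNdvd.
pose win z := (a * q < b * z < a.+1 * q)%N.
have winv z : win z -> v z != 0.
  move=> /andP[az za]; apply: vlt; apply/andP; split.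
    by case: z az {za} => //; rewrite muln0.
  by rewrite -(ltn_pmul2l (ltnW b1)); apply: leq_trans za _;
    rewrite leq_mul2r ab orbT.
have nwin z : win z -> ~ (exists k, v z = v r * v b ^+ k).
  move=> wz [k e]; apply: nkz; exists k, z; split => //.
  by rewrite -!(val_Fp_nat qp) natrM natrX -/(v _) e.
(* The window avoids the coset of [r], and the index is at most 2, so only one coset remains for
   it. *)
have same y y' : win y -> win y' -> exists k, v y' = v y * v b ^+ k.
  move=> wy wy'; apply: (@same_coset_of_index_lt3 _ (v b) m (v r)) => //.
  - by rewrite card_Fp.
  - by rewrite v0.
  - exact: winv.
  - exact: winv.
  - exact: nwin.
  - exact: nwin.
pose P n := exists k, v n = v b ^+ k.
have Pdiv x y : v x != 0 -> P x -> P (x * y)%N -> P y.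
  move=> x0 [k xk] [l xyl].
  have [u hu] : exists u, v x * v b ^+ u = 1.
    have : exists k, v x = 1 * v b ^+ k by exists k; rewrite mul1r.
    by move=> /(same_coset_sym gm)[u ->]; exists u.
  exists (u + l)%N; rewrite exprD -xyl /v natrM mulrA [_ * x%:R]mulrC.
  by rewrite -/(v x) hu mul1r.
have P1 n : (b < n)%N -> (b * n < q)%N -> P n.
  move=> bn bnq.
  (* The interval from [a * n.-1 / b] to [a.+1 * n.-1 / b] has length at least 1 because [b < n], so
     it contains an integer. These bounds on [j] make [y] fall in the window as soon as
     [n * y - j * q] does. *)
  have [j /andP[j1 j2]] : exists j, (a * n.-1 <= b * j <= a.+1 * n.-1)%N.
    exists ((a.+1 * n.-1) %/ b)%N.
    have := divn_eq (a.+1 * n.-1) b; have := ltn_pmod (a.+1 * n.-1) (ltnW b1).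
    set A := (_ %/ _)%N; set B := (_ %% _)%N; rewrite mulSn.
    by move=> h1 h2; apply/andP; split; nia.
  have [//||y /andP[y1 y2]] :=
      @progression_meets_interval 0 (b * n) (q * (a + b * j)) q.
    by rewrite bnq muln_gt0 andbC; apply/andP; split; lia.
  rewrite add0n in y1 y2.
  have wy : win y.
    have n0 : (0 < n)%N by lia.
    suff : (a * q * n < b * y * n < a.+1 * q * n)%N.
      by rewrite !(ltn_pmul2r n0).
    apply/andP; split.
      apply: (@leq_ltn_trans (q * (a + b * j))); last by nia.
      by rewrite [(a * q)%N]mulnC -mulnA leq_mul2l; apply/orP; right; nia.
    apply: (@leq_trans (q * (a + b * j) + q)); first by nia.
    rewrite -{2}[q]muln1 -mulnDr [(a.+1 * q)%N]mulnC -mulnA leq_mul2l.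
    by apply/orP; right; nia.
  have jy : (j * q <= n * y)%N by nia.
  have wy' : win (n * y - j * q)%N.
    by rewrite /win mulnBr; apply/andP; split; nia.
  (* Modulo [q] the second window element is [n] times the first, so their quotient [n] is a power
     of [b]. *)
  have [k] := same _ _ wy wy'.
  rewrite /v natrB // natrM [X in _ - X]natrM pchar_Fp_0 // mulr0 subr0 mulrC.
  by move=> /(mulfI (winv _ wy)) e; exists k.
have Pb k : P (b ^ k)%N by exists k; rewrite /v natrX.
have P2 n : (0 < n)%N -> (b * n < q)%N -> P n.
  move=> n0 bnq; have [bn|nb] := ltnP b n; first exact: P1.
  (* For [n <= b], the number [b ^ 2 * n] is in the range of [P1], since
     [b ^ 3 * n <= b ^ 4 < q]. *)
  apply: (Pdiv (b ^ 2)%N) => //; last first.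
  - by apply: P1; rewrite -mulnn; nia.
  - by apply: vlt; rewrite -mulnn; apply/andP; split; nia.
have P3 n : (0 < n < q)%N -> P n.
  elim/ltn_ind: n => n IH /andP[n0 nq].
  have [|qbn] := ltnP (b * n) q; first exact: P2.
  have n1 : (1 < n)%N by nia.
  have := divn_eq q n; have := ltn_pmod q n0.
  set d := (q %/ n)%N; set e := (q %% n)%N => en qE.
  have e0 : (0 < e)%N.
    rewrite lt0n; apply/negP => /eqP e0.
    have /(prime_nt_dvdP qp) : (n %| q)%N by rewrite /dvdn -/e e0.
    by lia.
  have db : (d <= b)%N by nia.
  (* Here [d.+1 * n = q + (n - e)] reduces to [n - e < n], and [d.+1 <= b.+1] is small enough for
     [P2]. *)
  apply: (Pdiv d.+1 n).
  - by apply: vlt; nia.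
  - by apply: P2 => //; nia.
  have [k ek] : P (n - e)%N by apply: IH; lia.
  exists k; rewrite -ek.
  have -> : (d.+1 * n = q + (n - e))%N by rewrite mulSn {1}qE; lia.
  by rewrite /v natrD pchar_Fp_0 // add0r.
have [//||y /andP[y1 y2]] := @progression_meets_interval 0 b (a * q) q.
  by rewrite bltq andbT ltnW.
have wy : win y by rewrite /win mulSn; apply/andP; split; lia.
apply: (nwin _ wy).
have hy : exists k, v y = 1 * v b ^+ k.
  have [k] : P y.
    apply: P3; apply/andP; split; first by case: (y) y1 => //; rewrite muln0.
    nia.
  by move=> ->; exists k; rewrite mul1r.
apply: same_coset_trans hy.
have [k] : P (r %% q)%N by apply: P3; rewrite ltn_pmod // andbT lt0n.
rewrite /v Fp_nat_mod // => rk.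
by apply: (same_coset_sym gm); exists k; rewrite mul1r.
Qed.
(** The order of [b] divides [q - 1 = 2 * p] with [p] prime. If [p] did not divide it, it would
    divide 2 and [q] would divide [b ^ 2 - 1], which lies strictly between 0 and [q]. So the order
    is at least [p]. *)
Lemma safe_prime_order (b q : nat) : safe_prime q -> (1 < b)%N ->
  (b ^ 2 < q)%N ->
  exists m, m.-primitive_root (b%:R : 'F_q) /\ (q.-1 < 3 * m)%N.
Proof.
move=> /andP[qp pp] b1 bq.
have b0 : (0 < b)%N by apply: ltnW.
have bsq : (b < b ^ 2)%N by rewrite -mulnn -{1}[b]muln1 ltn_pmul2l.
have bq0 : b%:R != 0 :> 'F_q.
  by rewrite -(dvdn_pcharf (pchar_Fp qp)) gtnNdvd // (ltn_trans bsq).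
have q2 : (q.-1 = 2 * q.-1./2)%N.
  have [qE|oq] := even_prime qp; first by rewrite qE in pp.
  have p0 := prime_gt0 qp.
  by rewrite mul2n -[LHS]odd_double_half -subn1 oddB // oq.
set p := q.-1./2 in pp q2.
have bp : (b%:R : 'F_q) ^+ q.-1 = 1.
  apply: (mulfI bq0); rewrite -exprS prednK ?prime_gt0 // mulr1.
  by have := expf_card (b%:R : 'F_q); rewrite card_Fp.
have q10 : (0 < q.-1)%N by rewrite q2 muln_gt0 (prime_gt0 pp).
have [m bm mq] := prim_order_exists q10 bp; exists m; split => //.
have pm : (p %| m)%N.
  apply: contraT; rewrite -prime_coprime // coprime_sym => mp.
  move: mq; rewrite q2 Gauss_dvdl // => m2.
  have : (b%:R : 'F_q) ^+ 2 == 1 by rewrite -(prim_order_dvd bm).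
  rewrite -subr_eq0 -natrX -(natrB _ (ltnW (leq_ltn_trans b0 bsq))).
  rewrite -(dvdn_pcharf (pchar_Fp qp)) gtnNdvd //.
    by rewrite subn_gt0; apply: leq_ltn_trans bsq.
  exact: leq_ltn_trans (leq_subr _ _) bq.
have := dvdn_leq (prim_order_gt0 bm) pm; have := prime_gt0 pp; rewrite q2; lia.
Qed.

(** * Denominators with prescribed primes, powers, and safe primes *)

Lemma power_orbit_meets_gap (b B e s r a : nat) :
  (1 < b)%N -> B = (b ^ e)%N -> (1 < B)%N ->
  (forall q, prime q -> (q %| s)%N -> B = 1 %[mod q ^ 2]) ->
  (r <= s)%N -> coprime s r -> (b * B.-1 < s)%N ->
  exists k z, z = (r * b ^ k)%N %[mod s] /\ (a * s < b * z < a.+1 * s)%N.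
Proof.
move=> b1 BE B1 Bq rs sr bs.
have b0 : (0 < b)%N by apply: ltnW.
have B0 : (0 < B.-1)%N by case: (B) B1 => [|[]].
have s0 : (0 < s)%N by apply: leq_ltn_trans bs.
(* The gap is translated by [b * s], one period of [z], so that the progression starts below it; the
   witness for [z] subtracts [s] again. *)
have [||t /andP[t1 t2]] :=
    @progression_meets_interval (b * r) (b * B.-1) ((a + b) * s) s.
- by rewrite mulnDl; apply: leq_trans (leq_addl _ _); rewrite leq_mul2l rs orbT.
- by rewrite muln_gt0 b0 B0.
have [n nE] := geom_sum_full_period t s0 B1 Bq sr.
have sz : (s <= r + B.-1 * t)%N.
  rewrite -(leq_pmul2l b0) mulnDr mulnA; apply: leq_trans (ltnW t1).
  by rewrite mulnDl leq_addl.
exists (e * n)%N, (r + B.-1 * t - s)%N; split.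
  rewrite expnM -BE expn_geom ?(ltnW B1) // mulnDr muln1 mulnCA.
  rewrite -[in RHS]modnDmr -modnMmr nE modnMmr modnDmr.
  by rewrite -[in RHS](subnK sz) modnDr.
by rewrite mulnBr mulnDr mulnA; apply/andP; split; lia.
Qed.

Lemma cantor_rat_nat (R : realType) (b : nat) (W : {set 'I_b})
    (r : int) (s : nat) :
  (0 < s)%N -> missing_digit_cantor W (r%:~R / s%:R : R) ->
  exists2 n : nat, r = n & (n <= s)%N.
Proof.
move=> s0 [/andP[]]; have sR : 0 < s%:R :> R by rewrite ltr0n.
rewrite ler_pdivlMr // mul0r ler0z ler_pdivrMr // mul1r.
by case: r => // n _ ns _; exists n => //; rewrite -(ler_nat R).
Qed.

Lemma finite_cantor_smooth (R : realType) (b : nat) (W : {set 'I_b})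
    (S : set nat) :
  (1 < b)%N -> W \proper [set: 'I_b]%SET -> finite_set S ->
  (forall q, S q -> prime q /\ ~~ (q %| b)%N) ->
  finite_set [set x : R | missing_digit_cantor W x /\
    exists (r : int) (s : nat),
      [/\ (0 < s)%N, (forall q, prime q -> (q %| s)%N -> S q)
        & x = r%:~R / s%:R]].
Proof.
move=> b1 /properP[_ [a _ aW]] /finite_seqP[l lS] Sq.
have inS q : q \in l -> S q by rewrite lS.
pose M := (\prod_(q <- l) q ^ 2)%N.
have cbM : coprime b M.
  rewrite /M big_seq; elim/big_rec: _ => [|q x ql bx]; first exact: coprimen1.
  have [qp qb] := Sq q (inS q ql).
  by rewrite coprimeMr bx andbT coprimeXr // coprime_sym prime_coprime.
have M0 : (0 < M)%N.
  rewrite /M big_seq; apply: prodn_cond_gt0 => q ql.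
  by rewrite expn_gt0 prime_gt0 //; case: (Sq q (inS q ql)).
(* By Euler, [B] is 1 modulo [M], hence modulo each [q ^ 2] at once. *)
set e := totient M; set B := (b ^ e)%N.
have B1 : (1 < B)%N by rewrite -(exp1n e) ltn_exp2r // totient_gt0.
have Bq q : S q -> B = 1 %[mod q ^ 2].
  rewrite lS /= => ql.
  have /(congr1 (modn^~ (q ^ 2)%N)) := Euler_exp_totient cbM.
  by rewrite !modn_dvdm // /M (big_rem _ ql) /= dvdn_mulr.
apply: (@finite_bounded_denominator _ _ (b * B.-1)).
move=> x [Cx [r [s [s0 sS xE]]]].
rewrite xE in Cx *.
have [n rn ns] := cantor_rat_nat s0 Cx; subst r.
set g := gcdn n s; have g0 : (0 < g)%N by rewrite gcdn_gt0 s0 orbT.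
have gn : (n %/ g * g = n)%N by rewrite divnK // dvdn_gcdl.
have gs : (s %/ g * g = s)%N by rewrite divnK // dvdn_gcdr.
have gR : g%:R != 0 :> R by rewrite pnatr_eq0 -lt0n.
have xg : n%:R / s%:R = (n %/ g)%:R / (s %/ g)%:R :> R.
  by rewrite -{1}gn -{1}gs !natrM invfM mulrACA divff // mulr1.
move: Cx; rewrite -pmulrn xg => Cx.
have ns' : (n %/ g <= s %/ g)%N by exact: leq_div2r.
have s0' : (0 < s %/ g)%N by rewrite divn_gt0 // dvdn_leq // dvdn_gcdr.
exists (n %/ g)%N, (s %/ g)%N; split => //.
rewrite leqNgt; apply/negP => Bs.
have [| |k [z [zE]]] := @power_orbit_meets_gap b B e (s %/ g) (n %/ g) a
  b1 erefl B1 _ ns' _ Bs.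
- move=> q qp qs; apply: Bq; apply: sS => //.
  by rewrite -gs dvdn_mulr.
- by rewrite /coprime gcdnC -(eqn_pmul2r g0) mul1n muln_gcdl gn gs.
- exact: (cantor_orbit_avoids_gap aW s0' Cx zE).
Qed.

(** All primes in the denominators [q ^ n] divide [q], so this is the smooth case for the prime
    divisors of [q]. *)
Lemma finite_cantor_powers (R : realType) (b : nat) (W : {set 'I_b})
    (p : int) (q : nat) :
  (1 < b)%N -> W \proper [set: 'I_b]%SET -> (0 < q)%N -> coprime b q ->
  finite_set [set x : R | missing_digit_cantor W x /\
    exists2 n : nat, (0 < n)%N & x = (p%:~R / q%:R) ^+ n].
Proof.
move=> b1 hW q0 bq; pose S := [set` primes q].
apply: sub_finite_set (@finite_cantor_smooth R b W S b1 hW _ _).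
- move=> x [Cx [n n0 xE]]; split => //; exists (p ^+ n), (q ^ n)%N; split.
  + by rewrite expn_gt0 q0.
  + by move=> l lp; rewrite Euclid_dvdX // /S /= mem_primes lp q0 => /andP[].
  + by rewrite xE expr_div_n rmorphXn natrX.
- exact: finite_seq.
- move=> l; rewrite /S /= mem_primes => /and3P[lp _ lq]; split => //.
  rewrite -prime_coprime // coprime_sym; exact: coprime_dvdr lq bq.
Qed.

Lemma finite_cantor_safe_prime (R : realType) (b : nat) (W : {set 'I_b}) :
  (1 < b)%N -> W \proper [set: 'I_b]%SET ->
  finite_set [set x : R | missing_digit_cantor W x /\
    exists (p : int) (q : nat), safe_prime q /\ x = p%:~R / q%:R].
Proof.
move=> b1 /properP[_ [a _ aW]].
apply: (@finite_bounded_denominator _ _ (b ^ 4)) => x [Cx [p [q [sq xE]]]].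
have qp : prime q by case/andP: sq.
have q0 := prime_gt0 qp; rewrite xE in Cx *.
have [n rn nq] := cantor_rat_nat q0 Cx; subst p.
have [qb|bq] := leqP q (b ^ 4); first by exists n, q.
(* If [q] divides the numerator, [x] is the integer 0 or 1, which has denominator 1. *)
have [/dvdnP[c nE]|qn] := boolP (q %| n)%N.
  have c1 : (c <= 1)%N by rewrite -(leq_pmul2r q0) mul1n -nE.
  exists c, 1%N; split => //; first by rewrite expn_gt0 ltnW.
  by rewrite nE -pmulrn natrM mulfK ?divr1 // pnatr_eq0 -lt0n.
have [|m [bm qm]] := safe_prime_order sq b1.
  by apply: ltn_trans bq; rewrite ltn_exp2l.
have [k [z [zE]]] := coset_meets_gap qp b1 bq (ltn_ord a) bm qm qn.
by move=> /(cantor_orbit_avoids_gap aW q0 Cx zE).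
Qed.

Theorem corollary4p4 (R : realType) (b : nat) (W : {set 'I_b})
  (hb : (3 <= b)%N) (hW : W \proper [set: 'I_b]%SET) (hW2 : (2 <= #|W|)%N) :
  [/\ forall S : set nat, finite_set S ->
        (forall q, S q -> prime q /\ ~~ (q %| b)%N) ->
        finite_set [set x : R | missing_digit_cantor W x /\
          exists (r : int) (s : nat),
            [/\ (0 < s)%N,
                (forall q, prime q -> (q %| s)%N -> S q)
              & x = r%:~R / s%:R]],
      forall (p : int) (q : nat), (0 < q)%N -> coprime b q ->
        finite_set [set x : R | missing_digit_cantor W x /\
          exists2 n : nat, (0 < n)%N & x = (p%:~R / q%:R) ^+ n]
    & finite_set [set x : R | missing_digit_cantor W x /\
        exists (p : int) (q : nat), safe_prime q /\ x = p%:~R / q%:R]].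
Proof.
have b1 : (1 < b)%N by exact: ltnW.
split.
- by move=> S; exact: finite_cantor_smooth.
- by move=> p q; exact: finite_cantor_powers.
- exact: finite_cantor_safe_prime.
Qed.
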